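(* Let $X_0\in\mathbb{R}^{n\times n}$ be a matrix such that (i) $\mathcal{Q}(X_0)\geq 0$; (ii) $0\leq X_0\leq S$; (iii) $-[(X_0^T\otimes A+I\otimes AX_0)+I\otimes B]$ is a nonsingular M-matrix. Let $(n_k)_{k\ge 0}$ be any sequence of nonnegative integers. Then the Newton-Shamanskii algorithm with initial value $X_0$, defined for $k=0,1,2,\dots$ by $$X_{k,0}=X_k-(\mathcal{Q}'_{X_k})^{-1}\mathcal{Q}(X_k),$$ $$X_{k,s}=X_{k,s-1}-(\mathcal{Q}'_{X_k})^{-1}\mathcal{Q}(X_{k,s-1}),\quad s=1,2,\dots,n_k,$$ $$X_{k+1}=X_{k,n_k},$$ generates a (well-defined) sequence $\{X_k\}$ such that $X_k\leq X_{k+1}\leq S$ for all $k\geq 0$, and $\lim_{k\to\infty}X_k=S$.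
   Context: Matrix inequalities are entrywise: $A\geq B$ means $a_{ij}\geq b_{ij}$ for all $i,j$. $I$ is the $n\times n$ identity matrix, $e=(1,\dots,1)^T$, and $\otimes$ is the Kronecker product. Standing assumptions: $A,B,C\in\mathbb{R}^{n\times n}$ satisfy $A\geq 0$, $B+I\geq 0$, $C\geq 0$, the matrix $A+B+I+C$ is irreducible, and $(A+B+I+C)e=e$. The associated quasi-birth-death process is positive recurrent, i.e. $\rho<1$, where $\rho=p^T(B+I+2A)e$ and $p$ is the stationary probability vector of the stochastic matrix $A+B+I+C$ ($p^T(A+B+I+C)=p^T$, $p^Te=1$). For $X\in\mathbb{R}^{n\times n}$ put $\mathcal{Q}(X)=AX^2+BX+C$. $S$ denotes the entrywise minimal nonnegative solution of $\mathcal{Q}(X)=0$ (that is, $S\ge 0$, $\mathcal{Q}(S)=0$, and $S\leq X$ for every $X\geq 0$ with $\mathcal{Q}(X)=0$); its existence is a known fact. The Fréchet derivative of $\mathcal{Q}$ at $X$ is the linear map $\mathcal{Q}'_X:\mathbb{R}^{n\times n}\to\mathbb{R}^{n\times n}$, $\mathcal{Q}'_X(Z)=AZX+AXZ+BZ$; under column-stacking vectorization it is represented by the matrix $X^T\otimes A+I\otimes AX+I\otimes B$. A real square matrix is a Z-matrix if all its off-diagonal entries are nonpositive. A Z-matrix written as $sI-N$ with $N\geq 0$ is a nonsingular M-matrix if $s>\rho(N)$, where $\rho(N)$ here denotes the spectral radius of $N$. Known fact (recalled in the paper from the literature): if $A\geq 0$, $B+I\geq 0$, $C\geq 0$, the matrix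 $A+B+I+C$ is irreducible, $(A+B+I+C)e=e$, and the associated quasi-birth-death process is positive recurrent (i.e. $\rho=p^T(B+I+2A)e<1$), then $-[(S^T\otimes A+I\otimes AS)+I\otimes B]$ is a nonsingular M-matrix. *)

(* Defs.v *)
From HB Require Import structures.
From mathcomp Require Import all_boot all_order all_algebra.
From mathcomp Require Import all_classical all_reals all_analysis.
From mathcomp Require Import complex mxtens.
Set Implicit Arguments.
Unset Strict Implicit.
Unset Printing Implicit Defensive.
Import Order.TTheory GRing.Theory Num.Theory.
Local Open Scope classical_set_scope.
Local Open Scope ring_scope.

Definition mxle (R : realType) (m n : nat) (A B : 'M[R]_(m, n)) : Prop :=
  forall i j, A i j <= B i j.

(* Not permutation-similar to a block triangular matrix: no nonempty proper
   index set K has a vanishing (K, complement of K) block.  Every 1 x 1 matrix,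
   including 0, is irreducible under this convention. *)
Definition irreducible_mx (R : realType) (n : nat) (A : 'M[R]_n) : Prop :=
  forall K : {set 'I_n}, K != finset.set0 -> K != [set: 'I_n]%SET ->
    exists i j, [/\ i \in K, j \notin K & A i j != 0].

(* The eigenvalues are the complex ones; for n = 0 the set is empty and its sup
   is 0. *)
Definition spectral_radius (R : realType) (n : nat) (A : 'M[R]_n) : R :=
  sup [set Normc.normc l |
        l in [set l : R[i] | eigenvalue (map_mx (real_complex R) A) l]].

Definition Z_matrix (R : realType) (n : nat) (M : 'M[R]_n) : Prop :=
  forall i j, i != j -> M i j <= 0.

Definition nonsingular_M_matrix (R : realType) (n : nat) (M : 'M[R]_n) : Prop :=
  Z_matrix M /\
  exists (s : R) (N : 'M[R]_n),
    [/\ M = s%:M - N, mxle 0 N & spectral_radius N < s].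

Definition ones (R : realType) (n : nat) : 'cV[R]_n := const_mx 1.

Definition stationary_prob (R : realType) (n : nat) (P : 'M[R]_n)
    (p : 'cV[R]_n) : Prop :=
  [/\ mxle 0 p, p^T *m P = p^T & p^T *m ones R n = 1%:M].

Definition drift (R : realType) (n : nat) (A B : 'M[R]_n) (p : 'cV[R]_n) : R :=
  (p^T *m (B + 1%:M + 2 *: A) *m ones R n) ord0 ord0.

Definition Qmap (R : realType) (n : nat) (A B C X : 'M[R]_n) : 'M[R]_n :=
  A *m (X *m X) + B *m X + C.

Definition minimal_nonneg_solution (R : realType) (n : nat)
    (A B C S : 'M[R]_n) : Prop :=
  [/\ mxle 0 S, Qmap A B C S = 0 &
      forall X : 'M[R]_n, mxle 0 X -> Qmap A B C X = 0 -> mxle S X].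

Definition dQ (R : realType) (n : nat) (A B X Z : 'M[R]_n) : 'M[R]_n :=
  A *m Z *m X + A *m X *m Z + B *m Z.

Fact dQ_is_linear (R : realType) (n : nat) (A B X : 'M[R]_n) :
  linear (dQ A B X).
Proof.
move=> a U V; rewrite /dQ !(mulmxDr, mulmxDl) -!(scalemxAr, scalemxAl) !scalerDr.
by rewrite [RHS]addrACA; congr (_ + _); rewrite [RHS]addrACA.
Qed.

HB.instance Definition _ (R : realType) (n : nat) (A B X : 'M[R]_n) :=
  GRing.isLinear.Build R 'M[R]_n 'M[R]_n _ (dQ A B X) (@dQ_is_linear R n A B X).

(* Matrix of dQ A B X under column-stacking vectorization. *)
Definition dQ_mx (R : realType) (n : nat) (A B X : 'M[R]_n) : 'M[R]_(n * n) :=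
  X^T *t A + 1%:M *t (A *m X) + 1%:M *t B.

(* The inverse below is total in MathComp, and is the genuine inverse exactly
   when dQ A B X is bijective. *)
Definition newton_update (R : realType) (n : nat) (A B C X Y : 'M[R]_n) :
    'M[R]_n :=
  Y - (linfun (dQ A B X))^-1%VF (Qmap A B C Y).

Fixpoint shamanskii_inner (R : realType) (n : nat) (A B C X : 'M[R]_n)
    (s : nat) : 'M[R]_n :=
  if s is s'.+1
  then newton_update A B C X (shamanskii_inner A B C X s')
  else newton_update A B C X X.

Fixpoint newton_shamanskii (R : realType) (n : nat) (A B C X0 : 'M[R]_n)
    (nk : nat -> nat) (k : nat) : 'M[R]_n :=
  if k is k'.+1
  then shamanskii_inner A B C (newton_shamanskii A B C X0 nk k') (nk k')
  else X0.

(* Main.v *)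
(* Write e for the vector of ones and L = A + AS + B. Since Q(S) = 0,
   L (1 - S) = A + B + C, so w^T = - p^T L is a left fixed vector of S, and
   positive recurrence gives w^T e > 0. By irreducibility the fixed vectors of S
   are multiples of e; as w <> 0 this forces S e = e, and then w >= 0 and L is
   invertible with L^-1 <= 0. Hence there is a row vector u >= 0 with
   u L = - e^T. As S e = e, the functional phi(Z) = u Z e satisfies
   phi(Z + Q'_S(Z)) = phi(Z) - e^T Z e, and Z + Q'_X(Z) <= Z + Q'_S(Z) for
   Z >= 0 and 0 <= X <= S. So - Q'_X is invertible with nonnegative inverse for
   every such X (a self-contained substitute for the M-matrix property at S).
   The Taylor expansion of Q then yields monotonicity, and the bound
   S - X_{k+1} <= D + Q'_S(D) with D = S - X_k, whose image under phi gives
   convergence. *)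
Require Import Defs.
From mathcomp Require Import all_boot all_order all_algebra.
From mathcomp Require Import all_classical all_reals all_analysis.
From mathcomp Require Import ring lra.
Import Order.TTheory GRing.Theory Num.Theory.
Import numFieldNormedType.Exports.
Local Open Scope classical_set_scope.
Local Open Scope ring_scope.

Set Implicit Arguments.
Unset Strict Implicit.
Unset Printing Implicit Defensive.

(** * Entrywise order on real matrices *)

Section Order.
Variable R : realType.

Lemma mxDE m n (A B : 'M[R]_(m, n)) i j : (A + B) i j = A i j + B i j.
Proof. by rewrite mxE. Qed.

Lemma mxNE m n (A : 'M[R]_(m, n)) i j : (- A) i j = - A i j.
Proof. by rewrite mxE. Qed.

Lemma mx_sub_ge0 m n (A B : 'M[R]_(m, n)) : mxle 0 (B - A) <-> mxle A B.
Proof.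
by split=> h i j; have := h i j; rewrite mxDE mxNE mxE subr_ge0.
Qed.

Lemma mxle_refl m n (A : 'M[R]_(m, n)) : mxle A A.
Proof. by []. Qed.

Lemma mxle_trans m n (B A C : 'M[R]_(m, n)) : mxle A B -> mxle B C -> mxle A C.
Proof. by move=> AB BC i j; apply: le_trans (BC i j). Qed.

Lemma mxle_anti m n (A B : 'M[R]_(m, n)) : mxle A B -> mxle B A -> A = B.
Proof. by move=> AB BA; apply/matrixP => i j; apply/le_anti; rewrite AB BA. Qed.

Lemma mxD_ge0 m n (A B : 'M[R]_(m, n)) :
  mxle 0 A -> mxle 0 B -> mxle 0 (A + B).
Proof.
move=> hA hB i j; have := hA i j; have := hB i j.
by rewrite mxDE mxE => *; apply: addr_ge0.
Qed.

Lemma mxM_ge0 m n q (A : 'M[R]_(m, n)) (B : 'M[R]_(n, q)) :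
  mxle 0 A -> mxle 0 B -> mxle 0 (A *m B).
Proof.
move=> hA hB i j; rewrite !mxE; apply: sumr_ge0 => k _.
by have := hA i k; have := hB k j; rewrite !mxE => *; apply: mulr_ge0.
Qed.

Lemma mxM_le m n q (A A' : 'M[R]_(m, n)) (B B' : 'M[R]_(n, q)) :
  mxle 0 A -> mxle 0 B -> mxle A A' -> mxle B B' -> mxle (A *m B) (A' *m B').
Proof.
move=> hA hB AA BB i j; rewrite !mxE; apply: ler_sum => k _.
by have := hA i k; have := hB k j; rewrite !mxE => *; apply: ler_pM.
Qed.

Lemma mxD_le m n (A A' B B' : 'M[R]_(m, n)) :
  mxle A A' -> mxle B B' -> mxle (A + B) (A' + B').
Proof. by move=> AA BB i j; rewrite !mxDE lerD. Qed.

Lemma ones_ge0 n : mxle 0 (ones R n).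
Proof. by move=> i j; rewrite !mxE ler01. Qed.

Lemma mulmx_onesE m n (A : 'M[R]_(m, n)) i j :
  (A *m ones R n) i j = \sum_k A i k.
Proof. by rewrite mxE; apply: eq_bigr => k _; rewrite mxE mulr1. Qed.

Lemma pos_mulmx_eq0 n (p : 'rV[R]_n) (x : 'cV[R]_n) :
  (forall i, 0 < p 0 i) -> mxle 0 x -> (p *m x) 0 0 <= 0 -> x = 0.
Proof.
move=> p_gt0 x_ge0 px; have x0 i : 0 <= x i 0 by have := x_ge0 i 0; rewrite mxE.
have s0 : \sum_i p 0 i * x i 0 = 0.
  apply: le_anti; rewrite sumr_ge0 ?andbT; first by rewrite mxE in px.
  by move=> i _; rewrite mulr_ge0 ?(ltW (p_gt0 i)).
apply/matrixP => i j; rewrite (ord1 j) mxE; apply/eqP.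
have /allP/(_ i) :
    all (fun i => true ==> (p 0 i * x i 0 == 0)) (index_enum 'I_n).
  rewrite -psumr_eq0 ?s0 // => k _; by rewrite mulr_ge0 ?(ltW (p_gt0 k)).
by rewrite mem_index_enum mulf_eq0 (gt_eqF (p_gt0 i)) /= => ->.
Qed.

Lemma unitmx_inj n (M : 'M[R]_n) :
  (forall y : 'cV[R]_n, M *m y = 0 -> y = 0) -> M \in unitmx.
Proof.
move=> inj; rewrite -unitmx_tr -row_free_unit; apply: inj_row_free => v vM.
apply: trmx_inj; rewrite trmx0; apply: inj.
by rewrite -[M]trmxK -trmx_mul vM trmx0.
Qed.

(** [N] is the negative part of [Z]: since [Z + N >= 0], one gets [0 <= T Z + T N <= Z + T N], hence
    [- Z <= T N]. Nonnegativity of [Z] thus reduces to excluding a nonzero [N >= 0] with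
    [N <= T N]. *)
Lemma super_fixpoint_neg_part m n (T : 'M[R]_(m, n) -> 'M[R]_(m, n)) Z :
  {morph T : U V / U + V} ->
  (forall N, mxle 0 N -> mxle 0 (T N)) -> mxle (T Z) Z ->
  exists N, [/\ mxle 0 N, mxle N (T N) & N = 0 -> mxle 0 Z].
Proof.
move=> T_add T_ge0 TZ; pose N : 'M[R]_(m, n) :=
  \matrix_(i, j) Num.max (- Z i j) 0.
have N_ge0 : mxle 0 N by move=> i j; rewrite !mxE le_max lexx orbT.
have ZN_ge0 : mxle 0 (Z + N).
  by move=> i j; rewrite !mxE -lerBlDl sub0r le_max lexx.
exists N; split=> // [i j|N0]; last by move: ZN_ge0; rewrite N0 addr0.
have := T_ge0 _ N_ge0 i j; have := T_ge0 _ ZN_ge0 i j; have := TZ i j.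
rewrite T_add mxDE !mxE ge_max => *; apply/andP; split=> //; lra.
Qed.

End Order.

Ltac mx_ge0 :=
  repeat first [assumption | apply: ones_ge0 | apply: mxM_ge0 | apply: mxD_ge0].

Ltac mxabel := apply/matrixP => ? ?; rewrite !(mxDE, mxNE); ring.

(** * Irreducible nonnegative matrices: stationary and harmonic vectors *)

Section Stochastic.
Variables (R : realType) (n : nat) (P : 'M[R]_n).
Hypotheses (P_ge0 : mxle 0 P) (P_irr : irreducible_mx P).

Lemma irreducible_closed_full (K : {set 'I_n}) i0 : i0 \in K ->
  (forall i j, i \in K -> j \notin K -> P i j = 0) -> K = [set: 'I_n]%SET.
Proof.
move=> i0K closed; apply/eqP/negP => /negP KT.
have K0 : K != finset.set0 by apply/set0Pn; exists i0.
have [i [j [iK jK]]] := P_irr K0 KT.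
by rewrite closed // eqxx.
Qed.

(** The support of [p] is closed under transitions: if [p j 0 = 0], entry [j] of [p^T *m P = p^T] is
    a vanishing sum of nonnegative terms. The support is nonempty because [p] has mass 1. *)
Lemma stationary_prob_gt0 p : stationary_prob P p -> forall i, 0 < p i 0.
Proof.
move=> [p_ge0 pP p1]; have p0 i : 0 <= p i 0 by have := p_ge0 i 0; rewrite mxE.
pose K := [set i | 0 < p i 0]%SET.
have [i0 i0K] : exists i, i \in K.
  apply/existsP; apply: contraT; rewrite negb_exists => /forallP h.
  have : (p^T *m ones R n) 0 0 = 0.
    rewrite mulmx_onesE big1 // => i _; rewrite mxE; apply: le_anti.
    by rewrite p0 andbT leNgt; have := h i; rewrite inE.
  by rewrite p1 mxE eqxx => /eqP; rewrite oner_eq0.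
suff KT : K = [set: 'I_n]%SET.
  by move=> i; have := finset.in_setT i; rewrite -KT inE.
apply: (irreducible_closed_full i0K) => i j; rewrite !inE => pi pj.
have pj0 : p j 0 = 0 by apply: le_anti; rewrite p0 andbT leNgt.
have /matrixP/(_ 0 j) := pP; rewrite !mxE pj0 => /eqP.
have P0 i' : 0 <= P i' j by have := P_ge0 i' j; rewrite mxE.
rewrite psumr_eq0 => [|k _]; last by rewrite mxE mulr_ge0.
move=> /allP/(_ i); rewrite mem_index_enum mxE mulf_eq0 (gt_eqF pi) /=.
by move=> /(_ isT)/eqP.
Qed.

(** Maximum principle: where [y] is maximal it equals its own average over a row of [P], so every
    index charged by that row is a maximiser too, and irreducibility spreads this to all indices. *)
Lemma harmonic_const (i0 : 'I_n) (y : 'cV[R]_n) :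
  P *m ones R n = ones R n -> P *m y = y -> y = y i0 0 *: ones R n.
Proof.
move=> P1 Py; pose m := [arg max_(i > i0) y i 0]%O.
have ym i : y i 0 <= y m 0 by rewrite /m; case: arg_maxP => // k _; apply.
pose K := [set i | y i 0 == y m 0]%SET.
have mK : m \in K by rewrite inE.
suff KT : K = [set: 'I_n]%SET.
  have yE i : y i 0 = y m 0.
    by apply/eqP; have := finset.in_setT i; rewrite -KT inE.
  by apply/matrixP => i j; rewrite (ord1 j) !mxE mulr1 !yE.
apply: (irreducible_closed_full mK) => i j; rewrite !inE => /eqP yi yj.
have P0 i' k : 0 <= P i' k by have := P_ge0 i' k; rewrite mxE.
have : \sum_k P i k * (y m 0 - y k 0) = 0.
  under eq_bigr do rewrite mulrBr.
  rewrite sumrB -mulr_suml -(mulmx_onesE P i 0) P1.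
  by move/matrixP: Py => /(_ i 0); rewrite mxE => ->; rewrite mxE mul1r yi subrr.
move=> /eqP; rewrite psumr_eq0 => [|k _]; last by rewrite mulr_ge0 // subr_ge0.
move=> /allP/(_ j); rewrite mem_index_enum mulf_eq0 subr_eq0.
rewrite [y m 0 == _]eq_sym (negPf yj).
by rewrite orbF => /(_ isT)/eqP.
Qed.

End Stochastic.

(** * Entrywise convergence of matrix sequences *)

Section EntrywiseLimit.
Variable R : realType.

(** Working entry by entry gives direct access to scalar limits; [mx_cvgP] returns to the topology
    of matrices. *)
Definition mx_cvg m n (u : nat -> 'M[R]_(m, n)) (U : 'M[R]_(m, n)) :=
  forall i j, u k i j @[k --> \oo] --> U i j.

Lemma mx_cvg_cst m n (U : 'M[R]_(m, n)) : mx_cvg (fun=> U) U.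
Proof. by move=> i j; apply: cvg_cst. Qed.

Lemma mx_cvgD m n (u v : nat -> 'M[R]_(m, n)) U V :
  mx_cvg u U -> mx_cvg v V -> mx_cvg (fun k => u k + v k) (U + V).
Proof.
move=> uU vV i j; rewrite mxE; under eq_fun do rewrite mxE.
by apply: cvgD.
Qed.

Lemma mx_cvgM m n q (u : nat -> 'M[R]_(m, n)) (v : nat -> 'M[R]_(n, q)) U V :
  mx_cvg u U -> mx_cvg v V -> mx_cvg (fun k => u k *m v k) (U *m V).
Proof.
move=> uU vV i j; rewrite mxE; under eq_fun do rewrite mxE.
by apply: cvg_big => [|l _]; [exact: add_continuous|apply: cvgM].
Qed.

Lemma mx_cvg_unique m n (u : nat -> 'M[R]_(m, n)) U V :
  mx_cvg u U -> mx_cvg u V -> U = V.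
Proof.
move=> uU uV; apply/matrixP => i j.
exact: (cvg_unique _ (uU i j) (uV i j)).
Qed.

Lemma mx_cvg_le m n (u : nat -> 'M[R]_(m, n)) U V :
  mx_cvg u U -> (forall k, mxle (u k) V) -> mxle U V.
Proof.
by move=> uU uV i j; apply: (cvgr_to_le (uU i j)); apply: nearW => k; apply: uV.
Qed.

Lemma mx_cvg_ge m n (u : nat -> 'M[R]_(m, n)) U V :
  mx_cvg u U -> (forall k, mxle V (u k)) -> mxle V U.
Proof.
by move=> uU uV i j; apply: (cvgr_to_ge (uU i j)); apply: nearW => k; apply: uV.
Qed.

Lemma mx_nondecreasing_cvg m n (u : nat -> 'M[R]_(m, n)) V :
  (forall k, mxle (u k) (u k.+1)) -> (forall k, mxle (u k) V) ->
  exists U, mx_cvg u U.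
Proof.
move=> u_inc uV; exists (\matrix_(i, j) sup (range (fun k => u k i j))) => i j.
rewrite mxE; apply: nondecreasing_cvgn.
  by apply/nondecreasing_seqP => k; apply: u_inc.
by exists (V i j) => _ [k _ <-]; apply: uV.
Qed.

Lemma mx_cvgP m n (u : nat -> 'M[R]_(m, n)) U : mx_cvg u U -> u @ \oo --> U.
Proof.
move=> uU; apply/cvg_ballP => e e_gt0.
have : \forall k \near \oo, forall i j, ball (U i j) e (u k i j).
  by apply: filter_forall => i; apply: filter_forall => j;
    move/cvg_ballP: (uU i j); apply.
by apply: filterS => k.
Qed.

End EntrywiseLimit.

(** * Stochasticity of the minimal solution and inversion of [L] *)

Section MinimalSolution.
Variables (R : realType) (n : nat) (A B C S : 'M[R]_n) (p : 'cV[R]_n).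
Hypotheses (A_ge0 : mxle 0 A) (BI_ge0 : mxle 0 (B + 1%:M)) (C_ge0 : mxle 0 C).
Hypothesis irr : irreducible_mx (A + B + 1%:M + C).
Hypothesis stoch : (A + B + 1%:M + C) *m ones R n = ones R n.
Hypothesis p_stat : stationary_prob (A + B + 1%:M + C) p.
Hypothesis pos_rec : drift A B p < 1.
Hypothesis S_min : minimal_nonneg_solution A B C S.

Let e : 'cV[R]_n := ones R n.
(** Once [S *m e = e] is known, [dQ A B S Z *m e = L *m (Z *m e)]: [L] is the derivative at [S] seen
    through row sums. *)
Let L : 'M[R]_n := A + A *m S + B.
Let w : 'rV[R]_n := - (p^T *m L).

Let S_ge0 : mxle 0 S. Proof. by case: S_min. Qed.

Let P_ge0 : mxle 0 (A + B + 1%:M + C).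
Proof. by rewrite -(addrA A); mx_ge0. Qed.

Let p_ABC : p^T *m (A + B + C) = 0.
Proof.
have -> : A + B + C = A + B + 1%:M + C - 1%:M by mxabel.
by case: p_stat => _ pP _; rewrite mulmxBr pP mulmx1 subrr.
Qed.

Let p_gt0 i : 0 < p^T 0 i.
Proof. by rewrite mxE; apply: stationary_prob_gt0 p_stat i. Qed.

Let ABC_ker y : (A + B + C) *m y = 0 -> exists c, y = c *: e.
Proof.
move=> ABCy; have Py : (A + B + 1%:M + C) *m y = y.
  have -> : A + B + 1%:M + C = A + B + C + 1%:M by mxabel.
  by rewrite mulmxDl ABCy mul1mx add0r.
(* [harmonic_const] needs an index; for [n = 0] the vector is empty and any constant serves. *)
have [i0 _|I0] := pickP (@predT 'I_n).
  by exists (y i0 0); exact: (harmonic_const P_ge0 irr i0 stoch Py).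
by exists 0; apply/matrixP => i; have := I0 i.
Qed.

(** The product expands to [A + B + C - Qmap A B C S]. In particular, a fixed vector of [S] lies in
    the kernel of [A + B + C]. *)
Lemma Qmap_solution_factor : (A + A *m S + B) *m (1%:M - S) = A + B + C.
Proof.
have [_ QS _] := S_min; rewrite -[RHS]subr0 -QS /L /Qmap.
by rewrite !(mulmxDl, mulmxDr, mulmxN, mulmx1, mulmxA); mxabel.
Qed.

(* The fixed-point iteration from 0 keeps row sums at most 1 and increases to a
   solution, which dominates S by minimality. *)
Lemma solution_substochastic : mxle (S *m ones R n) (ones R n).
Proof.
(* Adding [X] to [Qmap A B C X] turns zeros into fixed points and replaces [B] by [B + 1%:M >= 0],
   which makes [F] monotone on nonnegative matrices. *)
pose F X := A *m (X *m X) + (B + 1%:M) *m X + C.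
have FE X : F X = Qmap A B C X + X.
  by rewrite /F /Qmap mulmxDl mul1mx; mxabel.
have F_le X Y : mxle 0 X -> mxle X Y -> mxle (F X) (F Y).
  move=> X0 XY; have XX := mxM_ge0 X0 X0.
  by apply: mxD_le => //; apply: mxD_le; do !apply: mxM_le => //.
have F_ge0 X : mxle 0 X -> mxle 0 (F X).
  by move=> X0; rewrite /F; mx_ge0.
pose Y k := iter k F 0.
have Y_ge0 k : mxle 0 (Y k) by elim: k => [|k IH] //; apply: F_ge0.
have Y_inc k : mxle (Y k) (Y k.+1).
  by elim: k => [|k IH]; [exact: (Y_ge0 1%N)|exact: F_le].
have Ye k : mxle (Y k *m e) e.
  elim: k => [|k IH]; first by rewrite mul0mx; apply: ones_ge0.
  have eE : A *m e + (B + 1%:M) *m e + C *m e = e.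
    by rewrite -[RHS]stoch !mulmxDl; mxabel.
  have Ye0 : mxle 0 (Y k *m e) by have Yk := Y_ge0 k; mx_ge0.
  have YYe : mxle (Y k *m (Y k *m e)) e.
    exact: mxle_trans (mxM_le (Y_ge0 k) Ye0 (@mxle_refl _ _ _ _) IH) IH.
  rewrite -[X in mxle _ X]eE -[Y k.+1]/(F (Y k)) /F 2!mulmxDl -!mulmxA.
  apply: mxD_le => //; apply: mxD_le; apply: mxM_le => //.
  by have Yk := Y_ge0 k; mx_ge0.
have Y_bound k : mxle (Y k) (const_mx 1).
  move=> i j; rewrite mxE; have := Ye k i 0; rewrite mulmx_onesE mxE.
  apply: le_trans; rewrite (bigD1 j) //= lerDl; apply: sumr_ge0 => l _.
  by have := Y_ge0 k i l; rewrite mxE.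
have [U YU] := mx_nondecreasing_cvg Y_inc Y_bound.
have FU : F U = U.
  have YFU : mx_cvg (fun k => Y k.+1) (F U).
    by do !apply: mx_cvgD; do ?apply: mx_cvgM; do ?exact: mx_cvg_cst.
  by apply: mx_cvg_unique YFU _ => i j; have := YU i j; rewrite -cvg_shiftS.
have QU : Qmap A B C U = 0 by apply: (addIr U); rewrite -FE FU add0r.
have U_ge0 : mxle 0 U := mx_cvg_ge YU Y_ge0.
have [_ _ /(_ _ U_ge0 QU) SU] := S_min.
apply: (@mxle_trans _ _ _ (U *m e)); first exact: mxM_le (@ones_ge0 R n) _ _.
by apply: mx_cvg_le Ye; apply: mx_cvgM => //; apply: mx_cvg_cst.
Qed.

Let w_invariant : w *m S = w.
Proof.
apply/eqP; rewrite eq_sym -subr_eq0 -{1}(mulmx1 w) -mulmxBr /w mulNmx -mulmxA.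
by rewrite Qmap_solution_factor p_ABC oppr0.
Qed.

(** As [p^T *m e = 1], the number [w e] equals [1 - drift A B p] plus [p^T A (e - S e)]; the first
    part is positive by recurrence, the second nonnegative because [S] is substochastic. *)
Let w_ones_gt0 : 0 < (w *m e) 0 0.
Proof.
have [p_ge0 _ p1] := p_stat.
have d_ge0 := (mx_sub_ge0 _ _).2 solution_substochastic.
have pT_ge0 : mxle 0 p^T by move=> i j; rewrite (ord1 i) [X in X <= _]mxE ltW.
have : w *m e =
    1%:M - p^T *m (B + 1%:M + 2 *: A) *m e + p^T *m (A *m (e - S *m e)).
  rewrite -{1}p1 /w /L scaler_nat mulr2n.
  rewrite !(mulmxDl, mulmxDr, mulmxN, mulNmx, mulmx1, mulmxA).
  by rewrite /e; mxabel.
move=> ->; rewrite !(mxDE, mxNE) mxE eqxx.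
have := mxM_ge0 pT_ge0 (mxM_ge0 A_ge0 d_ge0) 0 0; rewrite mxE.
move: pos_rec; rewrite /drift -/e mulr1n.
set x := (_ *m e) 0 0; set y := (p^T *m (A *m _)) 0 0 => x1 y0.
by have x1' : x < 1 := x1; lra.
Qed.

Let S_ker y : S *m y = y -> exists c, y = c *: e.
Proof.
move=> Sy; apply: ABC_ker; rewrite -Qmap_solution_factor -mulmxA mulmxBl Sy.
by rewrite mul1mx subrr mulmx0.
Qed.

(* If 1 - S were injective, its nonzero left null vector w would vanish. *)
Lemma solution_stochastic : S *m ones R n = ones R n.
Proof.
have [[y [Sy y0]]|inj] := pselect (exists y : 'cV[R]_n, S *m y = y /\ y <> 0).
  have [c yE] := S_ker Sy; have c0 : c != 0.
    by apply/eqP => c0; apply: y0; rewrite yE c0 scale0r.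
  by move: Sy; rewrite yE -scalemxAr => /(scalerI c0).
have inv : 1%:M - S \in unitmx.
  apply: unitmx_inj => y; rewrite mulmxBl mul1mx => /eqP; rewrite subr_eq0.
  by move/eqP => Sy; apply: contrapT => y0; apply: inj; exists y.
have w0 : w = 0.
  by rewrite -(mulmxK inv w) mulmxBr mulmx1 w_invariant subrr mul0mx.
by move: w_ones_gt0; rewrite w0 mul0mx mxE ltxx.
Qed.

(* A rank-one update of 1 - S, injective because w (1 - S) = 0 and w e > 0. *)
Let K : 'M[R]_n := 1%:M - S + e *m p^T.

Let K_unit : K \in unitmx.
Proof.
have [_ _ p1] := p_stat.
apply: unitmx_inj => y Ky.
have pyE : e *m p^T *m y = (p^T *m y) 0 0 *: e.
  by rewrite -mulmxA {1}[p^T *m y]mx11_scalar mul_mx_scalar.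
have py0 : (p^T *m y) 0 0 = 0.
  have : w *m (K *m y) = (p^T *m y) 0 0 *: (w *m e).
    rewrite /K mulmxDl mulmxDr pyE -scalemxAr mulmxA mulmxBr mulmx1 w_invariant.
    by rewrite subrr mul0mx add0r.
  rewrite Ky mulmx0 => /matrixP/(_ 0 0); rewrite [RHS]mxE mxE => /esym/eqP.
  by rewrite mulf_eq0 (gt_eqF w_ones_gt0) orbF => /eqP.
(* The rank-one part of [K y] has vanished, so [S y = y]; then [p^T e = 1] turns [p^T y = 0] into
   [c = 0]. *)
have [c yE] : exists c, y = c *: e.
  apply: S_ker; apply/eqP; rewrite eq_sym -subr_eq0; apply/eqP.
  by move: Ky; rewrite /K mulmxDl pyE py0 scale0r addr0 mulmxBl mul1mx.
by move: py0; rewrite yE -scalemxAr p1 !mxE mulr1 => ->; rewrite scale0r.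
Qed.

(** Perron-Frobenius argument. [a = |w|] satisfies [a <= a S], with equality since [S e = e] equates
    the totals. Then [s a - t w] is a left fixed vector of [S] that annihilates [e], so [K]
    annihilates it on the right and it vanishes; [t >= s > 0] gives the sign of [w]. *)
Let w_ge0 : mxle 0 w.
Proof.
have [_ _ p1] := p_stat.
pose a : 'rV[R]_n := map_mx Num.norm w.
have S0 i j : 0 <= S i j by have := S_ge0 i j; rewrite mxE.
have aS_ge0 : mxle 0 (a *m S - a).
  apply/mx_sub_ge0 => i j; rewrite [a i j]mxE -{1}w_invariant.
  rewrite [X in `|X|]mxE [X in _ <= X]mxE.
  apply: le_trans (ler_norm_sum _ _ _) _.
  by apply: ler_sum => k _; rewrite normrM (ger0_norm (S0 _ _)) [a i k]mxE.
have aS : a *m S = a.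
  apply/eqP; rewrite -subr_eq0; apply/eqP; apply: trmx_inj; rewrite trmx0.
  apply: (@pos_mulmx_eq0 _ _ e^T) => [i|i j|]; first by rewrite !mxE ltr01.
    by have := aS_ge0 j i; rewrite !mxE.
  rewrite -trmx_mul mulmxBl -mulmxA solution_stochastic subrr trmx0 mxE.
  exact: lexx.
pose s := (w *m e) 0 0; pose t := (a *m e) 0 0.
have v0 : s *: a - t *: w = 0.
  rewrite -(mulmxK K_unit (s *: a - t *: w)) /K mulmxDr mulmxBr mulmx1.
  rewrite [_ *m S]mulmxBl -!scalemxAl aS w_invariant subrr add0r mulmxA.
  rewrite mulmxBl -!scalemxAl [a *m e]mx11_scalar [w *m e]mx11_scalar.
  by rewrite !scale_scalar_mx -/s -/t mulrC subrr !mul0mx.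
have st : s <= t.
  rewrite /s /t !mulmx_onesE; apply: ler_sum => k _.
  by rewrite [a _ _]mxE ler_norm.
have t_gt0 : 0 < t := lt_le_trans w_ones_gt0 st.
move=> i j; rewrite mxE (ord1 i).
move/eqP: v0; rewrite subr_eq0 => /eqP/matrixP/(_ 0 j); rewrite !mxE => sw.
by rewrite -(pmulr_rge0 _ t_gt0) -sw mulr_ge0 // ltW.
Qed.

(** Write [x = K y = (1 - S) y + c e]. From [w x = - p^T L x = 0] follows [c = 0]; then
    [L x = (A + B + C) y = 0] makes [y] a multiple of [e], which [1 - S] kills. *)
Let L_ker (x : 'cV[R]_n) : L *m x = 0 -> x = 0.
Proof.
move=> Lx; pose y := invmx K *m x; pose c := (p^T *m y) 0 0.
have xE : x = (1%:M - S) *m y + c *: e.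
  rewrite -[LHS](mulKVmx K_unit) -/y /K [LHS]mulmxDl -(mulmxA e); congr (_ + _).
  by rewrite {1}[p^T *m y]mx11_scalar mul_mx_scalar.
have : w *m x = c *: (w *m e).
  rewrite xE mulmxDr -scalemxAr mulmxA mulmxBr mulmx1 w_invariant subrr mul0mx.
  by rewrite add0r.
rewrite {1}/w mulNmx -mulmxA Lx mulmx0 oppr0 => /matrixP/(_ 0 0).
rewrite [RHS]mxE mxE => /esym/eqP.
rewrite mulf_eq0 (gt_eqF w_ones_gt0) orbF => /eqP c0.
move: xE; rewrite c0 scale0r addr0 => xE.
have [c' yE] : exists c', y = c' *: e.
  by apply: ABC_ker; rewrite -Qmap_solution_factor -mulmxA -xE.
by rewrite xE yE -scalemxAr mulmxBl mul1mx solution_stochastic subrr scaler0.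
Qed.

(** For the negative part [N], [N <= H N] means [L N >= 0], whereas [p^T L N = - w N <= 0]. As
    [p > 0], [L N = 0], and [L_ker] gives [N = 0]. *)
Let L_inverse_nonpos (x : 'cV[R]_n) : mxle 0 (- (L *m x)) -> mxle 0 x.
Proof.
move=> Lx; pose H := L + 1%:M.
have H_ge0 : mxle 0 H.
  rewrite /H /L -addrA; apply: mxD_ge0 => //.
  by apply: mxD_ge0 => //; apply: mxM_ge0.
have [|||N [N_ge0 HN]] := @super_fixpoint_neg_part _ _ _ (mulmx H) x.
- by move=> U V; rewrite mulmxDr.
- by move=> N; apply: mxM_ge0.
- apply/mx_sub_ge0; rewrite /H mulmxDl mul1mx.
  by have -> : x - (L *m x + x) = - (L *m x) by mxabel.
apply; apply: L_ker; have LN_ge0 : mxle 0 (L *m N).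
  by move/mx_sub_ge0: HN; rewrite /H mulmxDl mul1mx addrK.
apply: (pos_mulmx_eq0 p_gt0 LN_ge0).
have := mxM_ge0 w_ge0 N_ge0 0 0.
by rewrite /w mulNmx mxNE mxE oppr_ge0 mulmxA.
Qed.

(** Take [u = - e^T L^-1]. Its sign comes from [L_inverse_nonpos] applied to each column of
    [- L^-1], which [L] sends to minus a basis vector. *)
Lemma drift_certificate :
  exists2 u : 'rV[R]_n, mxle 0 u & u *m (A + A *m S + B) = - (ones R n)^T.
Proof.
have L_unit : L \in unitmx := unitmx_inj L_ker.
exists (- (e^T *m invmx L)); last by rewrite mulNmx mulmxKV.
rewrite -mulmxN; apply: mxM_ge0.
  by move=> i j; rewrite !mxE ler01.
move=> i j; have := @L_inverse_nonpos (- col j (invmx L)) _ i 0.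
rewrite !mxE; apply=> k l; rewrite mulmxN opprK colE mulmxA mulmxV // mul1mx.
by rewrite !mxE ler0n.
Qed.

End MinimalSolution.

(** * Inverse positivity of the derivative and one Newton step below [S] *)

Section NewtonStep.
Variables (R : realType) (n : nat) (A B C S : 'M[R]_n) (u : 'rV[R]_n).
Hypotheses (A_ge0 : mxle 0 A) (BI_ge0 : mxle 0 (B + 1%:M)).
Hypotheses (S_ge0 : mxle 0 S) (QS : Qmap A B C S = 0).
Hypothesis S_ones : S *m ones R n = ones R n.
Hypotheses (u_ge0 : mxle 0 u) (uE : u *m (A + A *m S + B) = - (ones R n)^T).

Let e : 'cV[R]_n := ones R n.
(** The shift by the identity makes [T X] preserve nonnegativity for [X >= 0], and turns
    [- dQ A B X Z >= 0] into [T X Z <= Z]. *)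
Let T (X Z : 'M[R]_n) : 'M[R]_n := dQ A B X Z + Z.
Let phi (Z : 'M[R]_n) : R := (u *m (Z *m e)) 0 0.
Let total (Z : 'M[R]_n) : R := (e^T *m (Z *m e)) 0 0.

Let onesT_ge0 : mxle 0 e^T.
Proof. by move=> i j; rewrite !mxE ler01. Qed.

Let TE X Z : T X Z = A *m Z *m X + A *m X *m Z + (B + 1%:M) *m Z.
Proof. by rewrite /T /dQ mulmxDl mul1mx; mxabel. Qed.

Let T_ge0 X Z : mxle 0 X -> mxle 0 Z -> mxle 0 (T X Z).
Proof. by move=> X0 Z0; rewrite TE; mx_ge0. Qed.

Let T_le X Z : mxle 0 X -> mxle 0 Z -> mxle X S -> mxle (T X Z) (T S Z).
Proof.
move=> X0 Z0 /mx_sub_ge0 XS; apply/mx_sub_ge0.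
have -> : T S Z - T X Z = A *m Z *m (S - X) + A *m (S - X) *m Z.
  by rewrite !TE !(mulmxBr, mulmxBl); mxabel.
by mx_ge0.
Qed.

Let phi_le Z Z' : mxle Z Z' -> phi Z <= phi Z'.
Proof.
move=> /mx_sub_ge0 ZZ; rewrite -subr_ge0 /phi.
have -> : (u *m (Z' *m e)) 0 0 - (u *m (Z *m e)) 0 0 =
    (u *m ((Z' - Z) *m e)) 0 0.
  by rewrite mulmxBl mulmxBr mxDE mxNE.
have e0 := @ones_ge0 R n.
have /(_ 0 0) : mxle 0 (u *m ((Z' - Z) *m e)) by mx_ge0.
by rewrite mxE.
Qed.

Let phi_T Z : phi (T S Z) = phi Z - total Z.
Proof.
rewrite /phi /total -mxNE -mxDE; congr (fun_of_matrix _ 0 0).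
have -> : T S Z *m e = (A + A *m S + B) *m (Z *m e) + Z *m e.
  by rewrite /T /dQ !mulmxDl -!mulmxA S_ones; mxabel.
by rewrite mulmxDr mulmxA uE mulNmx addrC.
Qed.

Let entry_le_total Z i j : mxle 0 Z -> Z i j <= total Z.
Proof.
move=> Z0; have Z0' k l : 0 <= Z k l by have := Z0 k l; rewrite mxE.
have totalE : total Z = \sum_k \sum_l Z k l.
  rewrite /total mxE; apply: eq_bigr => k _.
  by rewrite 2![X in X * _]mxE mul1r mulmx_onesE.
rewrite totalE (bigD1 i) //= (bigD1 j) //= -addrA lerDl addr_ge0 ?sumr_ge0 //.
by move=> k _; rewrite sumr_ge0.
Qed.

Let total_ge0 Z : mxle 0 Z -> 0 <= total Z.
Proof.
move=> Z0; have e0 := @ones_ge0 R n.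
have /(_ 0 0) : mxle 0 (e^T *m (Z *m e)) by mx_ge0.
by rewrite mxE.
Qed.

(** The negative part [N] of [Z] satisfies [N <= T X N <= T S N]. Applying [phi] gives
    [total N <= 0], hence [N = 0]. *)
Lemma dQ_inverse_nonpos X Z : mxle 0 X -> mxle X S ->
  mxle 0 (- dQ A B X Z) -> mxle 0 Z.
Proof.
move=> X0 XS dZ.
have [||| N [N0 TN]] := @super_fixpoint_neg_part _ _ _ (T X) Z.
- by move=> U V; rewrite /T linearD; mxabel.
- by move=> N; apply: T_ge0.
- by apply/mx_sub_ge0; have -> : Z - T X Z = - dQ A B X Z by rewrite /T; mxabel.
apply; have := phi_le (mxle_trans TN (T_le X0 N0 XS)).
rewrite phi_T lerBrDl gerDr => t0.
apply: mxle_anti => // i j; rewrite [X in _ <= X]mxE.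
exact: le_trans (entry_le_total _ _ N0) t0.
Qed.

Lemma dQ_injective X : mxle 0 X -> mxle X S -> injective (dQ A B X).
Proof.
move=> X0 XS Z Z' ZZ.
have le_Z V V' : dQ A B X V = dQ A B X V' -> mxle V' V.
  move=> VV; apply/mx_sub_ge0; apply: dQ_inverse_nonpos X0 XS _.
  by rewrite linearB /= VV subrr oppr0.
by apply: mxle_anti; apply: le_Z.
Qed.

Let lker_dQ X : mxle 0 X -> mxle X S -> lker (linfun (dQ A B X)) == 0%VS.
Proof.
move=> X0 XS; apply/lker0P => U V; rewrite !lfunE; exact: dQ_injective.
Qed.

(** The inverse exhibited is the one inside [newton_update], which is therefore genuine at such
    [X]. *)
Lemma dQ_bijective X : mxle 0 X -> mxle X S -> bijective (dQ A B X).
Proof.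
move=> X0 XS; exists (linfun (dQ A B X))^-1%VF => Z.
  by have := lker0_lfunK (lker_dQ X0 XS) Z; rewrite lfunE.
by have := lker0_lfunVK (lker_dQ X0 XS) Z; rewrite lfunE.
Qed.

(** Expansion at [Y] with the derivative frozen at [X]. The bracket collects the freezing error and
    the quadratic term; it is nonnegative when [X <= Y] and [E >= 0]. *)
Let Qmap_taylor X Y E : Qmap A B C (Y + E) =
  Qmap A B C Y + dQ A B X E +
    (A *m E *m (Y - X) + A *m (Y - X) *m E + A *m E *m E).
Proof.
rewrite /Qmap /dQ.
by rewrite !(mulmxDr, mulmxDl, mulmxBr, mulmxBl, mulmxA, mulmxN, mulNmx); mxabel.
Qed.

Lemma newton_update_bounds X Y (Y' := newton_update A B C X Y) :
  mxle 0 X -> mxle X Y -> mxle Y S -> mxle 0 (Qmap A B C Y) ->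
  [/\ mxle Y Y', mxle Y' S, mxle 0 (Qmap A B C Y')
    & mxle (S - Y') (dQ A B S (S - Y) + (S - Y))].
Proof.
move=> X0 XY YS QY.
have XS := mxle_trans XY YS; have Y0 := mxle_trans X0 XY.
pose E := Y' - Y; have Y'E : Y' = Y + E by rewrite /E; mxabel.
have dE : dQ A B X E = - Qmap A B C Y.
  have -> : E = - ((linfun (dQ A B X))^-1%VF (Qmap A B C Y)).
    by rewrite /E /Y' /newton_update; mxabel.
  rewrite linearN /=.
  have := lker0_lfunVK (lker_dQ X0 XS) (Qmap A B C Y).
  by rewrite lfunE => ->.
have E0 : mxle 0 E by apply: dQ_inverse_nonpos X0 XS _; rewrite dE opprK.
have YX0 := (mx_sub_ge0 _ _).2 XY; have D0 := (mx_sub_ge0 _ _).2 YS.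
(* Taylor expansion of [Qmap A B C S = 0] around [Y]. Freezing at [Z = X] yields [Y' <= S]; freezing
   at [Z = S], where the remainder is [- A D D] with [D = S - Y], yields the last bound. *)
have QS' Z : 0 = Qmap A B C Y + dQ A B Z (S - Y) +
    (A *m (S - Y) *m (Y - Z) + A *m (Y - Z) *m (S - Y) +
     A *m (S - Y) *m (S - Y)).
  by rewrite -Qmap_taylor -QS; congr Qmap; mxabel.
split; first exact/mx_sub_ge0.
- apply/mx_sub_ge0; apply: dQ_inverse_nonpos X0 XS _.
  have -> : S - Y' = (S - Y) - E by rewrite /E; mxabel.
  rewrite linearB /= dE; have := QS' X.
  set d := dQ _ _ _ _; set q := Qmap _ _ _ _; set r := (r in _ = _ + r) => Q0.
  have -> : - (d - - q) = q + d + r - (d + q) by rewrite -Q0 sub0r; mxabel.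
  have -> : q + d + r - (d + q) = r by mxabel.
  by rewrite /r; mx_ge0.
- rewrite Y'E (Qmap_taylor X) dE subrr add0r; mx_ge0.
(* The Newton correction is at least that of the fixed-point step [Y + Qmap A B C Y], so [S - Y'] is
   at most [S - Y - Qmap A B C Y]. *)
have QE : mxle (Qmap A B C Y) E.
  apply/mx_sub_ge0; have -> : E - Qmap A B C Y = T X E by rewrite /T dE addrC.
  exact: T_ge0.
apply/mx_sub_ge0; have -> : dQ A B S (S - Y) + (S - Y) - (S - Y') =
    (E - Qmap A B C Y) + A *m (S - Y) *m (S - Y).
  rewrite -[RHS]addr0 (QS' S) /E.
  rewrite !(mulmxDr, mulmxDl, mulmxBr, mulmxBl, mulmxA, mulmxN, mulNmx); mxabel.
by apply: mxD_ge0; [exact/mx_sub_ge0|mx_ge0].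
Qed.

(** The last bound is won by the first update; further inner steps only shrink [S - Y], so it is
    uniform in [s]. *)
Lemma shamanskii_inner_bounds X s (Y := shamanskii_inner A B C X s) :
  mxle 0 X -> mxle X S -> mxle 0 (Qmap A B C X) ->
  [/\ mxle X Y, mxle Y S, mxle 0 (Qmap A B C Y)
    & mxle (S - Y) (dQ A B S (S - X) + (S - X))].
Proof.
move=> X0 XS QX; rewrite {}/Y; elim: s => [|s [XY YS QY DY]].
  exact: newton_update_bounds.
have [YY Y'S QY' _] := newton_update_bounds X0 XY YS QY.
split=> //=; first exact: mxle_trans YY.
apply: mxle_trans DY; apply: mxD_le => // i j.
by rewrite !mxNE lerN2.
Qed.

(** * Monotonicity and convergence of the iterates *)

Variables (X0 : 'M[R]_n) (nk : nat -> nat).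
Hypotheses (X0_ge0 : mxle 0 X0) (X0_le_S : mxle X0 S).
Hypothesis QX0_ge0 : mxle 0 (Qmap A B C X0).

Let X := newton_shamanskii A B C X0 nk.

Lemma newton_shamanskii_bounds k :
  [/\ mxle 0 (X k), mxle (X k) S & mxle 0 (Qmap A B C (X k))].
Proof.
elim: k => [|k [Xk0 XkS QXk]] //.
have [XX XS QX _] := shamanskii_inner_bounds (nk k) Xk0 XkS QXk.
by split=> //; apply: mxle_trans XX.
Qed.

Lemma newton_shamanskii_step k :
  [/\ mxle (X k) (X k.+1), mxle (X k.+1) S
    & mxle (S - X k.+1) (dQ A B S (S - X k) + (S - X k))].
Proof.
have [Xk0 XkS QXk] := newton_shamanskii_bounds k.
by have [] := shamanskii_inner_bounds (nk k) Xk0 XkS QXk.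
Qed.

(* Summing phi (S - X k.+1) <= phi (S - X k) - total (S - X k), where the totals
   decrease, gives the rate O(1/k). *)
Let error_bound k :
  k.+1%:R * total (S - X k) + phi (S - X k.+1) <= phi (S - X0).
Proof.
have step l : total (S - X l) + phi (S - X l.+1) <= phi (S - X l).
  have [_ _ /phi_le] := newton_shamanskii_step l.
  by rewrite phi_T lerBrDl.
elim: k => [|k IH]; first by rewrite mul1r; exact: step.
have [XX _ _] := newton_shamanskii_step k.
have le_total : total (S - X k.+1) <= total (S - X k).
  rewrite -subr_ge0; suff -> : total (S - X k) - total (S - X k.+1) =
      total (X k.+1 - X k) by apply: total_ge0; apply/mx_sub_ge0.
  rewrite /total -mxNE -mxDE -mulmxBr -mulmxBl.
  congr (fun_of_matrix (_ *m (_ *m _)) _ _).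
  by mxabel.
have := step k.+1; rewrite [k.+2%:R]mulrSr.
have : k.+1%:R * total (S - X k.+1) <= k.+1%:R * total (S - X k).
  by apply: ler_wpM2l.
move: IH; rewrite mulrDl mul1r; lra.
Qed.

Lemma newton_shamanskii_cvg : mx_cvg X S.
Proof.
move=> i j.
(* [harmonic k] is [1 / (k + 1)]: dropping the nonnegative [phi (S - X k.+1)] from [error_bound]
   bounds each entry of [S - X k] by [phi (S - X0) * harmonic k]. *)
have lim0 : S i j - phi (S - X0) * harmonic k @[k --> \oo] --> S i j.
  rewrite -[X in _ --> X]subr0 -[X in _ --> _ - X](mulr0 (phi (S - X0))).
  by apply: cvgB; [exact: cvg_cst|apply: cvgMr; exact: cvg_harmonic].
apply: (squeeze_cvgr _ lim0 (cvg_cst (S i j))); apply: nearW => k.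
have [_ XkS _] := newton_shamanskii_bounds k.
apply/andP; split; last exact: XkS.
rewrite lerBlDr -lerBlDl /harmonic ler_pdivlMr ?ltr0n //.
have D0 : mxle 0 (S - X k) by apply/mx_sub_ge0.
have phi0 : 0 <= phi (S - X k.+1).
  have [_ XS _] := newton_shamanskii_step k.
  have -> : 0 = phi 0 by rewrite /phi mul0mx mulmx0 mxE.
  by apply: phi_le; apply/mx_sub_ge0.
have := error_bound k; have := entry_le_total i j D0; rewrite mxDE mxNE => Dij.
have : k.+1%:R * (S i j - X k i j) <= k.+1%:R * total (S - X k).
  by apply: ler_wpM2l.
rewrite [_ * k.+1%:R]mulrC; lra.
Qed.

End NewtonStep.

Theorem theorem3p2 (R : realType) (n : nat) (A B C S X0 : 'M[R]_n)
    (p : 'cV[R]_n) (nk : nat -> nat)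
    (A_ge0 : mxle 0 A) (BI_ge0 : mxle 0 (B + 1%:M)) (C_ge0 : mxle 0 C)
    (irr : irreducible_mx (A + B + 1%:M + C))
    (stoch : (A + B + 1%:M + C) *m ones R n = ones R n)
    (p_stat : stationary_prob (A + B + 1%:M + C) p)
    (pos_rec : drift A B p < 1)
    (S_min : minimal_nonneg_solution A B C S)
    (QX0_ge0 : mxle 0 (Qmap A B C X0))
    (X0_ge0 : mxle 0 X0) (X0_le_S : mxle X0 S)
    (X0_M : nonsingular_M_matrix (- dQ_mx A B X0)) :
  let X := newton_shamanskii A B C X0 nk in
  [/\ forall k, bijective (dQ A B (X k)),
      forall k, mxle (X k) (X k.+1) /\ mxle (X k.+1) S
    & X @ \oo --> S].
Proof.
have [u u_ge0 uE] :=
  drift_certificate A_ge0 BI_ge0 C_ge0 irr stoch p_stat pos_rec S_min.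
have S_ones :=
  solution_stochastic A_ge0 BI_ge0 C_ge0 irr stoch p_stat pos_rec S_min.
have [_ QS _] := S_min.
split=> [k|k|].
- have [Xk0 XkS _] := newton_shamanskii_bounds A_ge0 BI_ge0 QS S_ones u_ge0 uE
    nk X0_ge0 X0_le_S QX0_ge0 k.
  exact (dQ_bijective A_ge0 BI_ge0 S_ones u_ge0 uE Xk0 XkS).
- by have [] := newton_shamanskii_step A_ge0 BI_ge0 QS S_ones u_ge0 uE
    nk X0_ge0 X0_le_S QX0_ge0 k.
apply: mx_cvgP; exact (newton_shamanskii_cvg A_ge0 BI_ge0 QS S_ones u_ge0 uE
  nk X0_ge0 X0_le_S QX0_ge0).
Qed.
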